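(* $$\sup_{f\in\mathcal{L}_2(1,1;[0,\infty[)}\|f'\|_\infty=2.$$
   Context: $\mathcal{L}_2(1,1;[0,\infty[)$ is the set of functions $f:[0,\infty)\to\mathbb{R}$ that are differentiable on $[0,\infty)$ (one-sided at $0$), with $f'$ absolutely continuous on every compact subinterval of $[0,\infty)$, such that $|f(t)|\le 1$ for all $t\ge 0$ and $|f''(t)|\le 1$ for almost every $t\ge 0$ (equivalently, $|f|\le1$ and $f'$ is $1$-Lipschitz). $\|\cdot\|_\infty$ is the (essential) supremum norm on $[0,\infty)$. *)

(* Defs.v *)
From HB Require Import structures.
From mathcomp Require Export all_boot all_order all_algebra.
From mathcomp Require Export all_classical all_reals all_analysis.
Export numFieldNormedType.Exports.
Set Implicit Arguments.
Unset Strict Implicit.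
Unset Printing Implicit Defensive.
Import Order.TTheory GRing.Theory Num.Theory.

Local Open Scope classical_set_scope.
Local Open Scope ring_scope.

(* A function on [0, +oo[ is represented by a total function R -> R of which
   only the values on [0, +oo[ are used. *)
Definition halfline (R : realType) : set R := `[0, +oo[.
Arguments halfline : clear implicits.

Lemma measurable_halfline (R : realType) : measurable (halfline R).
Proof. exact: measurable_itv. Qed.

(* The variable y stays in [0, +oo[, so the derivative is the right one at 0
   and the usual two-sided one at x > 0. *)
Definition hquot (R : realType) (f : R -> R) (x y : R) : R :=
  (f y - f x) / (y - x).

Definition hderivable (R : realType) (f : R -> R) (x : R) : Prop :=
  cvg (hquot f x y @[y --> within (halfline R) x^']).

Definition hderive (R : realType) (f : R -> R) (x : R) : R :=
  lim (hquot f x y @[y --> within (halfline R) x^']).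

Definition abs_continuous (R : realType) (a b : R) (g : R -> R) : Prop :=
  forall e : R, 0 < e -> exists2 d : R, 0 < d &
    forall (n : nat) (u v : 'I_n -> R),
      (forall i, [/\ a <= u i, u i <= v i & v i <= b]) ->
      trivIset [set: 'I_n] (fun i => `]u i, v i[%classic) ->
      \sum_(i < n) (v i - u i) < d ->
      \sum_(i < n) `|g (v i) - g (u i)| < e.

(* L_2(A, B; [0, +oo[): A bounds |f|, B bounds |f''|. *)
Record calL2 (R : realType) (A B : R) (f : R -> R) : Prop := CalL2 {
  calL2_derivable : forall t : R, 0 <= t -> hderivable f t ;
  calL2_abs_cont : forall a b : R, 0 <= a -> a <= b ->
    abs_continuous a b (hderive f) ;
  calL2_bound : forall t : R, 0 <= t -> `|f t| <= A ;
  calL2_bound2 : {ae lebesgue_measure, forall t : R, 0 <= t ->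
    hderivable (hderive f) t /\ `|hderive (hderive f) t| <= B}
}.

Definition halfline_measure (R : realType) :
    {measure set (measurableTypeR R) -> \bar R} :=
  mrestr lebesgue_measure (@measurable_halfline R).

Definition Linfty_norm (R : realType) (g : R -> R) : \bar R :=
  'N[halfline_measure R]_+oo [EFin \o g]%E.

(* Main.v *)
Require Import Defs.
From mathcomp Require Import ring lra measurable_realfun ess_sup_inf.
Import Order.TTheory GRing.Theory Num.Theory.
Local Open Scope classical_set_scope.
Local Open Scope ring_scope.

(* The bound |f''| <= 1 almost everywhere makes the absolutely continuous f'
   1-Lipschitz.  Hence |f (t + 2) - f t - 2 f' t| <= 2 for every t >= 0, and
   since |f (t + 2) - f t| <= 2 this gives |f' t| <= 2.  The bound is attained,
   at t = 0, by the function equal to 1 - (2 - t)^2 / 2 on [0, 2] and to 1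
   afterwards. *)

(** Real induction. The hypothesis carries [P] from a point just left of [x] to a point just right
    of it, so it serves both to reach the supremum of the points satisfying [P] and to pass beyond
    it, which is absurd unless [b] is within range. *)
Lemma interval_induction {R : realType} {a b : R} (P : R -> Prop) :
  a <= b -> P a ->
  (forall x, a <= x -> x <= b -> exists2 d, 0 < d &
    forall y z, a <= y -> x - d < y -> y <= x -> x <= z -> z < x + d ->
      z <= b -> P y -> P z) ->
  P b.
Proof.
move=> ab Pa step.
pose S := [set x | a <= x /\ x <= b /\ P x].
have Sa : S a by [].
have Sub : has_sup S by split; [exists a|exists b => x [_ []]].
have as_ : a <= sup S by apply: sup_upper_bound.
have sb : sup S <= b by apply: ge_sup; [exists a|move=> x [_ []]].
have [d d0 H] := step _ as_ sb.
have [y [ay [yb Py]] ys] := sup_adherent d0 Sub.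
have yS : y <= sup S by apply: sup_upper_bound.
have [bd|db] := ltP b (sup S + d).
  by apply: (H y b).
have zS : S (sup S + d / 2).
  split; first lra.
  split; first lra.
  by apply: (H y) => //; lra.
have := sup_upper_bound Sub zS; lra.
Qed.

(** * Half-line derivatives in epsilon-delta form *)

Section hderive_eps.
Context {R : realType}.

Lemma hderive_approx {f : R -> R} {x e : R} : 0 <= x -> hderivable f x -> 0 < e ->
  exists2 d, 0 < d & forall y, 0 <= y -> `|y - x| < d ->
    `|f y - f x - hderive f x * (y - x)| <= e * `|y - x|.
Proof.
move=> x0 fx e0.
have /cvgrPdist_le /(_ _ e0) : hquot f x y @[y --> within (halfline R) x^'] --> hderive f x by exact: fx.
rewrite /within /= /dnbhs /within /= => /nbhs_ballP [d /= d0 H].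
exists d => // y y0 yx.
have [->|yNx] := eqVneq y x; first by rewrite !subrr mulr0 subrr normr0 mulr0.
have yx0 : y - x != 0 by rewrite subr_eq0.
have := H y; rewrite /ball /= distrC => /(_ yx yNx).
rewrite /halfline /= in_itv /= andbT => /(_ y0).
rewrite /hquot -(ler_pM2r (x := `|y - x|)) ?normr_gt0 // -normrM mulrBl divfK //.
by rewrite distrC.
Qed.

Lemma hderive_eps {f : R -> R} {x l : R} : 0 <= x ->
  (forall e, 0 < e -> exists2 d, 0 < d & forall y, 0 <= y -> `|y - x| < d ->
    `|f y - f x - l * (y - x)| <= e * `|y - x|) ->
  hderivable f x /\ hderive f x = l.
Proof.
move=> x0 H.
(* Uniqueness of the limit needs a proper filter; the points [x + d / 2] lie to the right of [x],
   hence in the half-line even when [x = 0]. *)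
have PF : ProperFilter (within (halfline R) x^').
  apply: Build_ProperFilter_ex => P; rewrite /within /= /dnbhs /within /= => /nbhs_ballP [d /= d0 HP].
  exists (x + d / 2); apply: HP.
  - rewrite /ball /= opprD addrA subrr sub0r normrN gtr0_norm; lra.
  - by rewrite gt_eqF // ; lra.
  - by rewrite /halfline /= in_itv /= andbT; lra.
have C : hquot f x y @[y --> within (halfline R) x^'] --> l.
  apply/cvgrPdist_le => e e0; have [d d0 Hd] := H _ e0.
  rewrite /within /= /dnbhs /within /=; apply/nbhs_ballP; exists d => //= y.
  rewrite /ball /= distrC => yx yNx.
  rewrite /halfline /= in_itv /= andbT => y0.
  have yx0 : y - x != 0 by rewrite subr_eq0.
  rewrite /hquot -(ler_pM2r (x := `|y - x|)) ?normr_gt0 // -normrM mulrBl divfK //.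
  by rewrite distrC; exact: Hd.
by split; [apply/cvg_ex; exists l|exact: cvg_lim].
Qed.

End hderive_eps.

(** * Growth of absolutely continuous functions *)

Lemma sum_length_le {R : realType} {n : nat} {u v : 'I_n -> R} {U : set R} :
  measurable U -> (forall i, u i <= v i) ->
  trivIset [set: 'I_n] (fun i => `]u i, v i[%classic) ->
  (forall i, `]u i, v i[ `<=` U) ->
  ((\sum_(i < n) (v i - u i))%:E <= lebesgue_measure U)%E.
Proof.
move=> mU uv tI sU.
have mI i : measurable (`]u i, v i[%classic : set R) by exact: measurable_itv.
have -> : ((\sum_(i < n) (v i - u i))%:E =
    lebesgue_measure (\big[setU/set0]_(i < n) `]u i, v i[%classic))%E.
  rewrite measure_bigsetU_ord //.
  rewrite -sumEFin; apply: eq_bigr => i _.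
  rewrite [RHS](lebesgue_measure_itv `]u i, v i[) /= lte_fin.
  case: ltP => // vu; congr EFin; apply/eqP.
  by rewrite subr_eq0 eq_le vu uv.
apply: le_measure; rewrite ?inE //; first exact: bigsetU_measurable.
by apply: (big_ind (fun A => A `<=` U)) => // A B AU BU; rewrite subUset.
Qed.

(* Going from a to b, steps around a point outside N obey the derivative bound.
   Steps around a point of N stay in an open set U of small measure containing
   N; they are collected in the family u, v, to which absolute continuity of g
   applies. *)
Lemma abs_continuous_growth {R : realType} {a b K : R} {g : R -> R} {N : set R} :
  a <= b -> 0 <= K -> abs_continuous a b g ->
  measurable N -> lebesgue_measure N = 0%E ->
  (forall x e, a <= x -> x <= b -> ~ N x -> 0 < e -> exists2 d, 0 < d &
    forall y, a <= y -> `|y - x| < d -> `|g y - g x| <= (K + e) * `|y - x|) ->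
  `|g b - g a| <= K * (b - a).
Proof.
move=> ab K0 acg mN N0 Hg.
suff H e : 0 < e -> `|g b - g a| <= (K + e) * (b - a) + e.
  apply/ler_addgt0Pr => e e0.
  (* The error [e] is paid once per unit length and once for the collected intervals, that is
     [b - a + 1] times in total. *)
  have k0 : 0 < b - a + 1 by lra.
  have := H (e / (b - a + 1)) (divr_gt0 e0 k0).
  rewrite mulrDl -addrA -[X in _ + (_ + X)]mulr1 -mulrDr divfK ?gt_eqF //.
move=> e0.
have [d d0 Hd] := acg _ e0.
have [U [oU NU mUd]] : exists U : set R,
    [/\ open U, N `<=` U & (lebesgue_measure U < d%:E)%E].
  have Noo : (lebesgue_measure N < +oo)%E by rewrite N0 ltry.
  have [U [oU NU UN]] := lebesgue_regularity_outer mN Noo d0.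
  exists U; split => //; have mU : measurable U by exact: open_measurable.
  have : (lebesgue_measure ((U `\` N) `|` N) <=
          lebesgue_measure (U `\` N) + lebesgue_measure N)%E.
    by apply: measureU2 => //; exact: measurableD.
  by rewrite N0 adde0 setUC setDUK //; move=> /le_lt_trans; apply.
have mU : measurable U by exact: open_measurable.
(* The intervals are listed from left to right and end before [x], so a further one can be appended
   on the right without overlap. *)
pose Q x := exists n, exists u v : nat -> R,
  [/\ forall i, (i < n)%N -> [/\ a <= u i, u i <= v i, v i <= x &
                                 `]u i, v i[ `<=` U],
      forall i j, (i < j)%N -> (j < n)%N -> v i <= u j &
      `|g x - g a| <= (K + e) * (x - a) +
                      \sum_(0 <= i < n) `|g (v i) - g (u i)|].
have [n [u [v [uvP uvo le]]]] : Q b.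
  apply: (@interval_induction _ a b) => //.
    exists 0%N, (fun=> 0), (fun=> 0); split => //.
    by rewrite big_geq // !subrr normr0 mulr0 addr0.
  move=> x ax xb; have [Nx|Nx] := pselect (N x).
    have /nbhs_ballP [r /= r0 rU] : nbhs x U by apply: open_nbhs_nbhs; split => //; apply: NU.
    exists r => // y z ay xy yx xz zx zb [n [u [v [uvP uvo le]]]].
    exists n.+1, (fun i => if (i < n)%N then u i else y),
      (fun i => if (i < n)%N then v i else z); split.
    - move=> i _; case: ifPn => [/uvP [aui uvi vy iU]|_].
        by split => //; lra.
      split => //; first lra.
      move=> t /=; rewrite in_itv /= => /andP [yt tz]; apply: rU.
      rewrite /ball /= ltr_norml; lra.
    - move=> i j ij jn; have -> : (i < n)%N by rewrite (leq_trans ij).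
      by case: ifPn => [|_]; [exact: uvo|case: (uvP i _) => //; rewrite (leq_trans ij)].
    - rewrite big_nat_recr //= ltnn.
      under eq_big_nat => i /andP [_ ->] do [].
      have : (K + e) * (y - a) <= (K + e) * (z - a).
        by rewrite ler_wpM2l //; lra.
      have := ler_normD (g z - g y) (g y - g a); rewrite subrKA; lra.
  (* Outside [N] the family is unchanged: the increments from [y] to [x] and from [x] to [z] both
     obey the slope bound at [x]. *)
  have [r r0 Hr] := Hg _ _ ax xb Nx e0.
  exists r => // y z ay xy yx xz zx zb [n [u [v [uvP uvo le]]]].
  exists n, u, v; split => //.
    by move=> i /uvP [? ? ? ?]; split => //; lra.
  have yy : `|g y - g x| <= (K + e) * (x - y).
    have yx0 : y - x <= 0 by lra.
    by have := Hr y ay; rewrite (ler0_norm yx0) opprB; apply; lra.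
  have zz : `|g z - g x| <= (K + e) * (z - x).
    have zx0 : 0 <= z - x by lra.
    by have := Hr z; rewrite (ger0_norm zx0); apply; lra.
  have := ler_normD (g z - g x) (g x - g a).
  have := ler_normD (g x - g y) (g y - g a).
  rewrite !subrKA (distrC (g x) (g y)).
  lra.
have tI : trivIset [set: 'I_n] (fun i => `]u i, v i[%classic).
  apply/trivIsetP => i j _ _ ij; apply/seteqP; split => // t [] /=.
  rewrite !in_itv /= => /andP [ut tv] /andP [ut' tv'].
  have /orP [ij'|ij'] : (i < j)%N || (j < i)%N by rewrite -neq_ltn.
    have := uvo i j ij' (ltn_ord j); lra.
  have := uvo j i ij' (ltn_ord i); lra.
apply: le_trans le _; rewrite lerD2l big_mkord; apply: ltW.
apply: (Hd n (fun i => u i) (fun i => v i)) => //.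
  by move=> i; have [] := uvP i (ltn_ord i).
rewrite -lte_fin; apply: le_lt_trans mUd.
by apply: sum_length_le => // i; have [] := uvP i (ltn_ord i).
Qed.

(** * Upper bound for the derivative *)

Section calL2_theory.
Context {R : realType}.
Implicit Types (f : R -> R) (A B : R).

Lemma calL2_hderive_lipschitz {f A B} {s t : R} :
  0 <= B -> calL2 A B f -> 0 <= s -> s <= t ->
  `|hderive f t - hderive f s| <= B * (t - s).
Proof.
move=> B0 [_ acf _ [N [mN N0 sN]]] s0 st.
apply: (abs_continuous_growth st B0 (acf _ _ s0 st) mN N0) => x e sx _ Nx e0.
have x0 : 0 <= x by lra.
have [dx xB] : hderivable (hderive f) x /\ `|hderive (hderive f) x| <= B.
  by apply: contra_notP Nx => H; apply: sN => /(_ x0).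
have [d d0 Hd] := hderive_approx x0 dx e0.
exists d => // y sy yx.
have /(Hd y) /(_ yx) {}Hd : 0 <= y by lra.
rewrite mulrDl -lerBlDl; apply: le_trans Hd.
have := ler_wpM2r (normr_ge0 (y - x)) xB; rewrite -normrM.
have := lerB_dist (hderive f y - hderive f x) (hderive (hderive f) x * (y - x)).
lra.
Qed.

(** Interval induction replaces integration: the remainder is compared with [B * (x - t) ^+ 2 / 2],
    the primitive of the Lipschitz bound [B * (x - t)]. *)
Lemma taylor1_remainder_le {f B} {t h : R} :
  0 <= B -> (forall x, 0 <= x -> hderivable f x) ->
  (forall x y, 0 <= x -> x <= y -> `|hderive f y - hderive f x| <= B * (y - x)) ->
  0 <= t -> 0 <= h ->
  `|f (t + h) - f t - hderive f t * h| <= B * h ^+ 2 / 2.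
Proof.
move=> B0 df Lf t0 h0.
(* Per unit length, [e] covers the differentiation error and [B * e] the Riemann-sum error. *)
suff H e : 0 < e -> `|f (t + h) - f t - hderive f t * h| <=
    B * h ^+ 2 / 2 + (B + 1) * e * h.
  apply/ler_addgt0Pr => e e0.
  have k0 : 0 < (B + 1) * (h + 1) by apply: mulr_gt0; lra.
  apply: le_trans (H _ (divr_gt0 e0 k0)) _; rewrite lerD2l.
  have -> : (B + 1) * (e / ((B + 1) * (h + 1))) * h = e * (h / (h + 1)).
    by field; apply/andP; split; rewrite gt_eqF //; lra.
  rewrite -[leRHS]mulr1 ler_wpM2l //; first exact: ltW.
  by rewrite ler_pdivrMr; lra.
move=> e0.
pose D x := f x - f t - hderive f t * (x - t).
have -> : f (t + h) - f t - hderive f t * h = D (t + h).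
  by rewrite /D; congr (_ - _ * _); ring.
have -> : B * h ^+ 2 / 2 + (B + 1) * e * h =
  B * (t + h - t) ^+ 2 / 2 + (B + 1) * e * (t + h - t) by rewrite addrAC subrr add0r.
apply: (@interval_induction _ t (t + h)
  (fun x => `|D x| <= B * (x - t) ^+ 2 / 2 + (B + 1) * e * (x - t))).
- lra.
- by rewrite /D !subrr !mulr0 subrr normr0 expr0n /= !mulr0 mul0r addr0.
move=> x tx xh; have x0 : 0 <= x by lra.
have [d d0 Hd] := hderive_approx x0 (df _ x0) e0.
(* The radius is at most [e] so that [x] exceeds the midpoint of [y] and [z] by at most [e]. *)
exists (Num.min d e); first by rewrite lt_min d0.
move=> y z ty xy yx xz zx zh IH.
have md : Num.min d e <= d by rewrite ge_min lexx.
have me : Num.min d e <= e by rewrite ge_min lexx orbT.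
have yy : `|f y - f x - hderive f x * (y - x)| <= e * (x - y).
  have yx0 : y - x <= 0 by lra.
  by have := Hd y; rewrite (ler0_norm yx0) opprB; apply; lra.
have zz : `|f z - f x - hderive f x * (z - x)| <= e * (z - x).
  have zx0 : 0 <= z - x by lra.
  by have := Hd z; rewrite (ger0_norm zx0); apply; lra.
have xx : `|(hderive f x - hderive f t) * (z - y)| <= B * (x - t) * (z - y).
  have zy0 : 0 <= z - y by lra.
  by rewrite normrM (ger0_norm zy0) ler_wpM2r // Lf.
have -> : D z = D y + (hderive f x - hderive f t) * (z - y)
   + (f z - f x - hderive f x * (z - x)) - (f y - f x - hderive f x * (y - x)).
  by rewrite /D; ring.
(* B (x - t) (z - y) is a Riemann-sum term for the integral of B (s - t) over
   [y, z]; its error is absorbed by B e (z - y). *)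
have Bq : B * (x - t) * (z - y) <=
    B * (z - t) ^+ 2 / 2 - B * (y - t) ^+ 2 / 2 + B * e * (z - y).
  have -> : B * (z - t) ^+ 2 / 2 - B * (y - t) ^+ 2 / 2 + B * e * (z - y)
    = B * (((z + y) / 2 - t + e) * (z - y)) by field.
  rewrite -mulrA ler_wpM2l // ler_wpM2r; lra.
apply: le_trans (ler_normB _ _) _.
apply: le_trans (lerD (ler_normD _ _) (lexx _)) _.
apply: le_trans (lerD (lerD (ler_normD _ _) (lexx _)) (lexx _)) _.
apply: le_trans (lerD (lerD (lerD IH xx) zz) yy) _.
nra.
Qed.

Lemma calL2_hderive_le2 {f} {t : R} : calL2 1 1 f -> 0 <= t ->
  `|hderive f t| <= 2.
Proof.
move=> Lf t0; have [df _ bf _] := Lf.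
have Hl x y : 0 <= x -> x <= y -> `|hderive f y - hderive f x| <= 1 * (y - x).
  exact: (calL2_hderive_lipschitz ler01 Lf).
(* A step [h] bounds the derivative by [2 / h + h / 2], which is least at [h = 2]. *)
have := taylor1_remainder_le ler01 df Hl t0 (ler0n _ 2).
have := bf _ t0; have := bf (t + 2) (addr_ge0 t0 (ler0n _ 2)).
rewrite !ler_norml => /andP [? ?] /andP [? ?] /andP [? ?].
lra.
Qed.

End calL2_theory.

(** * The extremal function *)

Section extremal.
Context {R : realType}.

Definition extremal_deriv (x : R) : R := Num.max (2 - x) 0.
Definition extremal (x : R) : R := 1 - extremal_deriv x ^+ 2 / 2.

Lemma extremal_deriv_lipschitz (x y : R) :
  `|extremal_deriv y - extremal_deriv x| <= `|y - x|.
Proof.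
rewrite /extremal_deriv; wlog xy : x y / x <= y => [W|].
  by have [xy|/ltW yx] := leP x y; [|rewrite distrC (distrC y)]; exact: W.
have yx0 : 0 <= y - x by lra.
rewrite (ger0_norm yx0) ler_norml.
by case: (leP (2 - x) 0) => ?; case: (leP (2 - y) 0) => ?; apply/andP; split; lra.
Qed.

(** Any quadratic remainder yields the derivative, including at the junction point 2 of the two
    branches. *)
Lemma extremal_taylor (x y : R) :
  `|extremal y - extremal x - extremal_deriv x * (y - x)| <= (y - x) ^+ 2.
Proof.
rewrite /extremal /extremal_deriv ler_norml !expr2.
have := sqr_ge0 (y - x); rewrite expr2.
case: (leP (2 - x) 0) => hx; case: (leP (2 - y) 0) => hy; first by lra.
- have : 0 <= (2 - y) * (x - 2) by apply: mulr_ge0; lra.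
  have := sqr_ge0 (2 - y); have := sqr_ge0 (x - 2); rewrite !expr2.
  by lra.
- have : 0 <= (2 - x) * (y - 2) by apply: mulr_ge0; lra.
  have := sqr_ge0 (2 - x); have := sqr_ge0 (y - 2); rewrite !expr2.
  by lra.
- by lra.
Qed.

Lemma extremal_hderive {x : R} : 0 <= x ->
  hderivable extremal x /\ hderive extremal x = extremal_deriv x.
Proof.
move=> x0; apply: hderive_eps => // e e0; exists e => // y y0 yx.
apply: le_trans (extremal_taylor x y) _.
by rewrite -real_normK ?num_real // expr2 ler_wpM2r // ltW.
Qed.

Lemma extremal_hderive2 {x : R} : 0 <= x -> x != 2 ->
  hderivable (hderive extremal) x /\ `|hderive (hderive extremal) x| <= 1.
Proof.
move=> x0 x2.
pose l : R := if x < 2 then -1 else 0.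
have [dx ->] : hderivable (hderive extremal) x /\ hderive (hderive extremal) x = l.
  (* This radius keeps [y] on the same side of 2 as [x], where the derivative is affine and the
     error vanishes. *)
  apply: hderive_eps => // e e0; exists `|x - 2|; first by rewrite normr_gt0 subr_eq0.
  move=> y y0; rewrite (extremal_hderive y0).2 (extremal_hderive x0).2.
  rewrite ltr_norml /extremal_deriv /l => /andP [yx xy].
  suff -> : Num.max (2 - y) 0 - Num.max (2 - x) 0 =
      (if x < 2 then -1 else 0) * (y - x) by rewrite subrr normr0 mulr_ge0 // ltW.
  case: (ltP x 2) yx xy => xlt.
    have x20 : x - 2 < 0 by lra.
    rewrite (ltr0_norm x20) => yx xy.
    by case: (leP (2 - x) 0) => ?; case: (leP (2 - y) 0) => ?; lra.
  have x20 : 0 <= x - 2 by lra.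
  rewrite (ger0_norm x20) => yx xy.
  by case: (leP (2 - x) 0) => ?; case: (leP (2 - y) 0) => ?; lra.
by split => //; rewrite /l; case: ifP => _; rewrite ?normrN ?normr1 ?normr0.
Qed.

Lemma extremal_calL2 : calL2 1 1 extremal.
Proof.
split.
- by move=> t /extremal_hderive [].
- move=> a b a0 ab e e0; exists e => // n u v uvP _ uve.
  apply: le_lt_trans uve; apply: ler_sum => i _.
  have [au uv _] := uvP i.
  have u0 : 0 <= u i by lra.
  have v0 : 0 <= v i by lra.
  have vu0 : 0 <= v i - u i by lra.
  rewrite (extremal_hderive v0).2 (extremal_hderive u0).2 -(ger0_norm vu0).
  exact: extremal_deriv_lipschitz.
- move=> t t0; rewrite /extremal /extremal_deriv ler_norml.
  by case: (leP (2 - t) 0) => ?; apply/andP; split; nra.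
(* The derivative has a corner at 2, with slopes -1 and 0. *)
- exists [set 2]; split => //; first exact: lebesgue_measure_set1.
  move=> x /= H; apply/eqP; apply: contra_notT H => x2 x0.
  exact: extremal_hderive2.
Qed.

End extremal.

(** * The essential supremum norm and the value of the supremum *)

(** The norm of exponent [+oo] unfolds to an essential supremum only when the whole space has
    positive measure. *)
Lemma halfline_measureT_gt0 {R : realType} :
  (0 < halfline_measure R [set: R])%E.
Proof.
rewrite /halfline_measure /= /mrestr setTI /halfline.
by rewrite lebesgue_measure_itv /= ltry addye // ltry.
Qed.

Lemma Linfty_norm_le {R : realType} (g : R -> R) (c : R) :
  (forall t, 0 <= t -> `|g t| <= c) -> (Linfty_norm g <= c%:E)%E.
Proof.
move=> gc; rewrite /Linfty_norm unlock /Lnorm halfline_measureT_gt0.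
apply/ess_supP; exists (~` halfline R); split.
- by apply: measurableC; exact: measurable_halfline.
- by rewrite /halfline_measure /= /mrestr setICl measure0.
- move=> x /= H; apply: contra_not H; rewrite /halfline /= in_itv /= andbT => x0.
  by rewrite lee_fin gc.
Qed.

(** The value 2 is taken only at the null set of the origin, but for [c < 2] the derivative exceeds
    [c] on an interval of positive length starting there. *)
Lemma Linfty_norm_extremal {R : realType} :
  (2%:E <= Linfty_norm (hderive (@extremal R)))%E.
Proof.
rewrite leNgt; apply/negP; rewrite /Linfty_norm unlock /Lnorm halfline_measureT_gt0 => lt2.
have [c [c2 cs]] : exists c : R, c < 2 /\
   (ess_sup (halfline_measure R) (abse \o (EFin \o hderive extremal)) <= c%:E)%E.
  case E : ess_sup lt2 => [c| |] //=; first by rewrite lte_fin => c2; exists c.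
  by move=> _; exists 0; rewrite leNye.
have /ess_supP [N [mN N0 sN]] := cs.
(* For [x] below this minimum the derivative is [2 - x], which is larger than [c]. *)
have m0 : 0 < Num.min 2 (2 - c) by rewrite lt_min; lra.
have : (lebesgue_measure (`[0%R, (Num.min 2 (2 - c))%R[%classic : set R) <=
        lebesgue_measure (N `&` halfline R))%E.
  apply: le_measure; rewrite ?inE.
  - exact: measurable_itv.
  - by apply: measurableI => //; exact: measurable_halfline.
  move=> x /=; rewrite in_itv /= lt_min => /and3P [x0 x2 xc].
  split; last by rewrite /halfline /= in_itv /= x0.
  apply: sN => /=; apply/negP; rewrite -ltNge lte_fin (extremal_hderive x0).2.
  rewrite /extremal_deriv; case: (leP (2 - x : R) 0) => [?|m_gt0]; first lra.
  by rewrite (gtr0_norm m_gt0); lra.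
rewrite [X in (_ <= X)%E -> _]N0 lebesgue_measure_itv /= lte_fin m0.
by rewrite -EFinD lee_fin; lra.
Qed.

Theorem proposition12 (R : realType) :
  ereal_sup [set Linfty_norm (hderive f) | f in @calL2 R 1 1] = 2%:E.
Proof.
apply/eqP; rewrite eq_le; apply/andP; split.
  apply: ge_ereal_sup => _ [f Lf <-]; apply: Linfty_norm_le => t.
  exact: calL2_hderive_le2.
apply: le_trans Linfty_norm_extremal _; apply: ereal_sup_ubound.
by exists extremal => //; exact: extremal_calL2.
Qed.
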